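(* Let $E'=(0,1)\cap\mathbb{Q}$ and $I=[0,1]$. The error-sum function of Pierce expansions $\mathcal{E}\colon I\to\mathbb{R}$ is continuous on $I\setminus E'$, i.e. $\mathcal{E}$ is continuous (as a function on $I$) at every point of $I\setminus E'$; and so $\mathcal{E}$ is continuous at Lebesgue-almost every point of $I$.
   Context: Let $I=[0,1]$ and $\mathbb{N}_\infty=\mathbb{N}\cup\{\infty\}$ where $\mathbb{N}=\{1,2,3,\dots\}$, with the conventions $\infty+c=\infty$ and $c/\infty=0$ for $c\in\mathbb{R}$; a product of elements of $\mathbb{N}_\infty$ with a factor $\infty$ equals $\infty$. Define $d_1\colon I\to\mathbb{N}_\infty$ and $T\colon I\to I$ by $d_1(x)=\lfloor 1/x\rfloor$, $T(x)=1-d_1(x)\,x$ for $x\neq 0$, and $d_1(0)=\infty$, $T(0)=0$. For $n\in\mathbb{N}$ let $d_n(x)=d_1(T^{n-1}x)$ (the Pierce expansion digits of $x$), and let $s_n(x)=\sum_{k=1}^n\frac{(-1)^{k+1}}{d_1(x)\cdots d_k(x)}$. The error-sum function of Pierce expansions is $\mathcal{E}\colon I\to\mathbb{R}$, $\mathcal{E}(x)=\sum_{n=1}^\infty (x-s_n(x))$ (absolutely and uniformly convergent). *)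

(* Defs.v *)
From HB Require Import structures.
From mathcomp Require Import all_boot all_order all_algebra.
From mathcomp Require Import all_classical all_reals all_analysis.

Set Implicit Arguments.
Unset Strict Implicit.
Unset Printing Implicit Defensive.

Import Order.TTheory GRing.Theory Num.Theory.
Import numFieldNormedType.Exports.

Local Open Scope classical_set_scope.
Local Open Scope ring_scope.

(* All functions below are total on R; only their values on I = `[0, 1] are
   meaningful (pierceT maps I to I).  Digits are 1-indexed and take their values
   in {1, 2, ...} U {+oo}, seen inside \bar R: on such values, a product with a
   factor +oo is +oo, and +oo^-1 = 0. *)

Definition pierce_d1 (R : realType) (x : R) : \bar R :=
  if x == 0 then +oo%E else ((Num.floor (1 / x))%:~R)%:E.

Definition pierceT (R : realType) (x : R) : R :=
  if x == 0 then 0 else 1 - fine (pierce_d1 x) * x.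

Definition pierce_d (R : realType) (n : nat) (x : R) : \bar R :=
  pierce_d1 (iter n.-1 (@pierceT R) x).

Definition pierce_s (R : realType) (n : nat) (x : R) : R :=
  \sum_(1 <= k < n.+1)
    fine (((-1) ^+ k.+1)%:E / \prod_(1 <= j < k.+1) pierce_d j x)%E.

(* A limit in R, total by convention; the series converges for x in I. *)
Definition pierce_error_sum (R : realType) (x : R) : R :=
  limn (fun N : nat => \sum_(1 <= n < N.+1) (x - pierce_s n x)).

Definition pierce_E' (R : realType) : set R := `]0, 1[ `&` @rational R.

(* Continuity at x of the restriction of f to I, for x in I. *)
Definition continuous_on_I_at (R : realType) (f : R -> R) (x : R) : Prop :=
  f @ within `[0, 1] (nbhs x) --> f x.

(* Main.v *)
Require Import Defs.
From HB Require Import structures.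
From mathcomp Require Import all_boot all_order all_algebra.
From mathcomp Require Import all_classical all_reals all_analysis.
From mathcomp Require Import ring lra.

Import Order.TTheory GRing.Theory Num.Theory.
Import numFieldNormedType.Exports.

Local Open Scope classical_set_scope.
Local Open Scope ring_scope.

Set Implicit Arguments.
Unset Strict Implicit.
Unset Printing Implicit Defensive.

(** The error term x - s_n(x) obeys a recursion along the Pierce map: since
    x = (1 - T x) / d_1(x), one has
    x - s_(n+1)(x) = - (T x - s_n(T x)) / d_1(x).
    Unfolding it, x - s_n(x) = (-1)^n T^n(x) / (d_1(x) ... d_n(x)).

    As T maps I into [0, 1/2], every digit after the first is at least 2 (or
    infinite), hence |x - s_n(x)| <= 2^-n on I ([pierce_err_bound]).  The series
    defining the error sum therefore converges uniformly on I, and it is enough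
    to prove that each error term is continuous, relative to I, at the points
    of I outside E' ([half_dominated_sum_cvg]).

    At an irrational x of I, 1/x is not an integer, so d_1 is constant near x,
    and T is affine near x; since T x is again irrational, the recursion gives
    continuity for all n ([pierce_err_continuous]).  At 0 and 1 every error term
    vanishes for n >= 1, and it is squeezed by |x - s_n(x)| <= x
    ([pierce_err_le]) near 0 and by |x - s_n(x)| <= 1 - x
    ([pierce_errS_le_near1]) near 1.  The exceptional set E' consists of
    rationals, so it is Lebesgue-null. *)

(** * One step of the Pierce map *)

Section Digits.
Context {R : realType}.
Implicit Types x y : R.

(** The junk values fine +oo = 0 and 0^-1 = 0 conspire to give the convention
    1 / oo = 0 at x = 0, so that the formulas below need no special case. *)
Definition pierce_inv_d1 x : R := (fine (pierce_d1 x))^-1.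

(** The defining inequalities m <= 1 / x < m + 1 of the first digit m, cleared
    of denominators so that linear arithmetic applies. *)
Lemma pierce_step x : 0 < x <= 1 ->
  exists2 m : int, (1 <= m)%R &
  [/\ pierce_d1 x = (m%:~R)%:E, pierceT x = 1 - m%:~R * x,
      m%:~R * x <= 1 & 1 < (m%:~R + 1) * x].
Proof.
move=> /andP[x0 x1]; exists (Num.floor (1 / x)).
  by rewrite real_floor_ge_int ?num_real// ler_pdivlMr// mul1r.
have /andP[h1 h2] := floor_itv (1 / x).
rewrite /pierceT /pierce_d1 gt_eqF//; split => //.
- by rewrite -ler_pdivlMr.
- by move: h2; rewrite intrD -ltr_pdivrMr.
Qed.

Lemma pierce_inv_d1_0 : pierce_inv_d1 0 = 0.
Proof. by rewrite /pierce_inv_d1 /pierce_d1 eqxx invr0. Qed.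

Lemma pierceT0 : pierceT (0 : R) = 0.
Proof. by rewrite /pierceT eqxx. Qed.

Lemma pierce_inv_d1_ge0 x : 0 <= x <= 1 -> 0 <= pierce_inv_d1 x.
Proof.
case/andP; rewrite le_eqVlt => /predU1P[<- _|x0 x1].
  by rewrite pierce_inv_d1_0.
have [|m m1 [dE _ _ _]] := @pierce_step x; first by rewrite x0.
by rewrite /pierce_inv_d1 dE invr_ge0 ler0z (le_trans _ m1).
Qed.

Lemma pierce_inv_d1_le1 x : 0 <= x <= 1 -> pierce_inv_d1 x <= 1.
Proof.
case/andP; rewrite le_eqVlt => /predU1P[<- _|x0 x1].
  by rewrite pierce_inv_d1_0.
have [|m m1 [dE _ _ _]] := @pierce_step x; first by rewrite x0.
have m1' : 1 <= m%:~R :> R by rewrite ler1z.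
by rewrite /pierce_inv_d1 dE invf_le1// (lt_le_trans _ m1').
Qed.

Lemma pierce_inv_d1_le_half x : 0 <= x <= 2^-1 -> pierce_inv_d1 x <= 2^-1.
Proof.
case/andP; rewrite le_eqVlt => /predU1P[<- _|x0 x2].
  by rewrite pierce_inv_d1_0.
have [|m m1 [dE _ _ mx]] := @pierce_step x.
  by rewrite x0/=; lra.
have : 1 < m%:~R :> R by nra.
rewrite -[1]/(1%:~R) ltr_int => m2.
have : (2 <= m) by [].
rewrite -(ler_int R) => m2'.
by rewrite /pierce_inv_d1 dE/= lef_pV2// posrE; lra.
Qed.

(** For a first digit m >= 1, x > 1 / (m + 1) forces
    T x = 1 - m x < 1 / (m + 1) <= 1 / 2; that T sends I into its lower half
    is the source of the geometric decay of the errors. *)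
Lemma pierceT_itv x : 0 <= x <= 1 -> 0 <= pierceT x <= 2^-1.
Proof.
case/andP; rewrite le_eqVlt => /predU1P[<- _|x0 x1].
  by rewrite pierceT0 lexx invr_ge0 ler0n.
have [|m m1 [_ -> mx1 mx2]] := @pierce_step x; first by rewrite x0.
have m1' : 1 <= m%:~R :> R by rewrite ler1z.
by apply/andP; split; nra.
Qed.

Lemma pierceT_le x : 0 <= x <= 1 -> pierceT x <= x.
Proof.
case/andP; rewrite le_eqVlt => /predU1P[<- _|x0 x1]; first by rewrite pierceT0.
have [|m m1 [_ -> mx1 mx2]] := @pierce_step x; first by rewrite x0.
nra.
Qed.

(** The identity T x = 1 - d_1 x solved for x: the engine of the recursion. *)
Lemma pierce_inv_d1_mul x : 0 <= x <= 1 -> pierce_inv_d1 x * (1 - pierceT x) = x.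
Proof.
case/andP; rewrite le_eqVlt => /predU1P[<- _|x0 x1].
  by rewrite pierce_inv_d1_0 mul0r.
have [|m m1 [dE -> _ _]] := @pierce_step x; first by rewrite x0.
have m0 : m%:~R != 0 :> R by rewrite intr_eq0 gt_eqF// (lt_le_trans _ m1).
by rewrite /pierce_inv_d1 dE/=; field.
Qed.

Lemma pierce_d1_gt0 x : 0 <= x <= 1 -> (0 < pierce_d1 x)%E.
Proof.
case/andP; rewrite le_eqVlt => /predU1P[<- _|x0 x1].
  by rewrite /pierce_d1 eqxx ltry.
have [|m m1 [-> _ _ _]] := @pierce_step x; first by rewrite x0.
by rewrite lte_fin ltr0z (lt_le_trans _ m1).
Qed.

Lemma pierceT_unit x : 0 <= x <= 1 -> 0 <= pierceT x <= 1.
Proof. by move=> /pierceT_itv/andP[-> h]; lra. Qed.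

Lemma iter_pierceT_unit n x : 0 <= x <= 1 -> 0 <= iter n (@pierceT R) x <= 1.
Proof. by move=> ?; elim: n => //= n; exact: pierceT_unit. Qed.

(** * Errors of the partial sums *)

(** Here too the value 0 of fine +oo is harmless: an infinite factor sends both
    sides to 0, because the other factor is positive. *)
Lemma fineM_gt0 (x y : \bar R) : (0 < x)%E -> (0 < y)%E ->
  fine (x * y)%E = fine x * fine y.
Proof.
move: x y => [x| |] [y| |]//; rewrite ?lte_fin => x0 y0.
- by rewrite gt0_muley ?lte_fin// mulr0.
- by rewrite gt0_mulye ?lte_fin// mul0r.
- by rewrite mulyy mul0r.
Qed.

Lemma fine_prod_gt0 (I : Type) (s : seq I) (F : I -> \bar R) :
  (forall i, 0 < F i)%E ->
  (0 < \prod_(i <- s) F i)%E /\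
  fine (\prod_(i <- s) F i)%E = \prod_(i <- s) fine (F i).
Proof.
move=> F0; elim: s => [|i s [s0 IH]]; first by rewrite !big_nil lte_fin.
by rewrite !big_cons mule_gt0// fineM_gt0// IH.
Qed.

Lemma fine_div_gt0 (a : R) (x : \bar R) : (0 < x)%E ->
  fine (a%:E / x)%E = a / fine x.
Proof.
case: x => [x| |]//; last by rewrite invey mule0 invr0 mulr0.
by rewrite lte_fin => x0; rewrite inver gt_eqF.
Qed.

(** Sums and products are reindexed from 0, and everything takes place in the
    reals: a digit +oo contributes a factor 0. *)
Lemma pierce_sE n x : 0 <= x <= 1 ->
  pierce_s n x = \sum_(k < n)
    (-1) ^+ k * \prod_(j < k.+1) pierce_inv_d1 (iter j (@pierceT R) x).
Proof.
move=> x01; rewrite /pierce_s big_add1 big_mkord; apply: eq_bigr => k _.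
have d0 j : (0 < pierce_d j x)%E by exact/pierce_d1_gt0/iter_pierceT_unit.
have [D0 DE] := fine_prod_gt0 (index_iota 1 k.+2) d0.
by rewrite fine_div_gt0// DE !exprS !mulN1r opprK -prodfV big_add1 big_mkord.
Qed.

(** The error x - s_n(x), by recursion on the first digit rather than on the
    last one: regularity at x then follows from regularity at T x. *)
Fixpoint pierce_err n x : R :=
  if n is n'.+1 then - (pierce_inv_d1 x * pierce_err n' (pierceT x)) else x.

Lemma pierce_errE n x : 0 <= x <= 1 -> x - pierce_s n x = pierce_err n x.
Proof.
elim: n x => [|n IH] x x01; first by rewrite pierce_sE// big_ord0 subr0.
rewrite /= -IH ?pierceT_unit// !pierce_sE ?pierceT_unit// big_ord_recl/=.
rewrite big_ord_recl big_ord0 mulr1 mul1r -{1}[x]pierce_inv_d1_mul//.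
under eq_bigr => k _.
  rewrite big_ord_recl/= exprS mulN1r mulNr mulrCA.
  under eq_bigr => j _ do rewrite add0n -iterS iterSr.
  over.
by rewrite sumrN -mulr_sumr; ring.
Qed.

End Digits.

(** * Size of the error terms *)

Section Bounds.
Context {R : realType}.
Implicit Types x y : R.

Lemma pierce_err_le n x : 0 <= x <= 1 -> `|pierce_err n x| <= x.
Proof.
elim: n x => [|n IH] x x01 /=; first by rewrite ger0_norm; case/andP: x01.
rewrite normrN normrM (ger0_norm (pierce_inv_d1_ge0 x01)).
rewrite -[leRHS]mul1r ler_pM ?pierce_inv_d1_ge0 ?pierce_inv_d1_le1//.
exact: le_trans (IH _ (pierceT_unit x01)) (pierceT_le x01).
Qed.

(** Above 1 / 2 the first digit is 1, so T x = 1 - x, and the error at x is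
    minus an error at 1 - x. *)
Lemma pierce_errS_le_near1 n x : 2^-1 < x <= 1 -> `|pierce_err n.+1 x| <= 1 - x.
Proof.
case/andP=> x2 x1; have x01 : 0 <= x <= 1 by lra.
rewrite /= normrN normrM (ger0_norm (pierce_inv_d1_ge0 x01)).
have Tx : pierceT x = 1 - x.
  have [|m m1 [_ -> mx1 mx2]] := @pierce_step R x; first by lra.
  suff -> : m = 1 by rewrite mul1r.
  apply/eqP; rewrite eq_le m1 andbT -ltzD1 -(ltr_int R) intrD.
  have m1' : 1 <= m%:~R :> R by rewrite ler1z.
  nra.
rewrite -[leRHS]mul1r ler_pM ?pierce_inv_d1_ge0 ?pierce_inv_d1_le1//.
by rewrite -Tx pierce_err_le// pierceT_unit.
Qed.

(** On [0, 1/2], which T preserves, each step multiplies by 1 / d_1 <= 1 / 2;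
    the starting value contributes the extra factor in the exponent n + 1. *)
Lemma pierce_err_half n x : 0 <= x <= 2^-1 -> `|pierce_err n x| <= 2^-1 ^+ n.+1.
Proof.
elim: n x => [|n IH] x x2 /=; first by rewrite ger0_norm; case/andP: x2.
have x01 : 0 <= x <= 1 by lra.
rewrite normrN normrM (ger0_norm (pierce_inv_d1_ge0 x01)) exprS.
rewrite ler_pM ?pierce_inv_d1_ge0 ?pierce_inv_d1_le_half//.
exact/IH/pierceT_itv.
Qed.

(** The first step has no gain, since d_1 may be 1, but it lands in [0, 1/2],
    where the bound is one power better. *)
Lemma pierce_err_bound n x : 0 <= x <= 1 -> `|pierce_err n x| <= 2^-1 ^+ n.
Proof.
case: n => [|n] x01; first by rewrite ger0_norm; case/andP: x01.
rewrite /= normrN normrM (ger0_norm (pierce_inv_d1_ge0 x01)).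
rewrite -[leRHS]mul1r ler_pM ?pierce_inv_d1_ge0 ?pierce_inv_d1_le1//.
exact/pierce_err_half/pierceT_itv.
Qed.

(** * Continuity of the error terms *)

(** Near x the map T is affine with integer coefficients and nonzero slope. *)
Lemma pierceT_irrational x :
  0 < x <= 1 -> ~ rational x -> ~ rational (pierceT x).
Proof.
move=> x01; apply: contra_not => -[q _ qT].
have [m m1 [_ Tx _ _]] := pierce_step x01.
have m0 : m%:~R != 0 :> R by rewrite intr_eq0 gt_eqF// (lt_le_trans _ m1).
exists ((1 - q) / m%:~R) => //.
rewrite fmorph_div/= rmorphB rmorph1 rmorph_int/= qT Tx.
by field.
Qed.

Lemma irrational_neq0 x : ~ rational x -> x != 0.
Proof.
move=> xirr; apply: contra_notN xirr => /eqP ->.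
by exists 0 => //; rewrite rmorph0.
Qed.

(** Irrationality makes m <= 1 / x < m + 1 strict on both sides, hence stable
    under a small perturbation of x. *)
Lemma near_pierce_d1 x : 0 < x <= 1 -> ~ rational x ->
  \forall y \near x, y != 0 /\ pierce_d1 y = pierce_d1 x.
Proof.
move=> x01 xirr; have [m m1 [dE _ mx mx2]] := pierce_step x01.
have m0 : m%:~R != 0 :> R by rewrite intr_eq0 gt_eqF// (lt_le_trans _ m1).
have mx1 : m%:~R * x < 1.
  rewrite lt_neqAle mx andbT; apply: contra_notN xirr => /eqP mx_eq.
  (* equality m x = 1 would make x = 1 / m rational *)
  exists (m%:~R^-1) => //; rewrite fmorphV/= rmorph_int.
  by apply: (mulfI m0); rewrite mx_eq mulfV.
have cvgZ (a : R) : a * y @[y --> x] --> a * x.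
  by apply: cvgMl_tmp; exact: cvg_id.
near=> y.
have y0 : 0 < y by near: y; apply: (cvgr_gt x) => //; case/andP: x01.
rewrite gt_eqF//; split => //; rewrite dE /pierce_d1 gt_eqF//.
congr (_%:~R%:E); apply: floor_def; rewrite intrD ler_pdivlMr// ltr_pdivrMr//.
apply/andP; split.
  by near: y; apply: (cvgr_le _ (cvgZ _)).
by near: y; apply: (cvgr_gt _ (cvgZ _)).
Unshelve. all: by end_near. Qed.

Lemma pierce_err_continuous n x : 0 < x <= 1 -> ~ rational x ->
  pierce_err n y @[y --> x] --> pierce_err n x.
Proof.
elim: n x => [|n IH] x x01 xirr; first exact: cvg_id.
have nearx := near_pierce_d1 x01 xirr.
have w_cvg : pierce_inv_d1 y @[y --> x] --> pierce_inv_d1 x.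
  apply: cvg_near_cst; near=> y.
  have [_ dy] : y != 0 /\ pierce_d1 y = pierce_d1 x by near: y.
  by rewrite /pierce_inv_d1 dy.
have T_cvg : pierceT y @[y --> x] --> pierceT x.
  have lin : 1 - fine (pierce_d1 x) * y @[y --> x] -->
      1 - fine (pierce_d1 x) * x.
    by apply: cvgB; [exact: cvg_cst|apply: cvgMl_tmp; exact: cvg_id].
  rewrite [pierceT x]/pierceT (negbTE (irrational_neq0 xirr)).
  apply: cvg_trans lin; apply: near_eq_cvg; near=> y.
  have [y0 dy] : y != 0 /\ pierce_d1 y = pierce_d1 x by near: y.
  by rewrite /pierceT (negbTE y0) dy.
have Tirr := pierceT_irrational x01 xirr.
have T01 : 0 < pierceT x <= 1.
  have /andP[T0 ->] : 0 <= pierceT x <= 1 by apply: pierceT_unit; lra.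
  by rewrite lt_neqAle T0 eq_sym irrational_neq0.
apply: cvgN; apply: cvgM => //.
exact: (cvg_comp _ _ T_cvg (IH _ T01 Tirr)).
Unshelve. all: by end_near. Qed.

End Bounds.

(** * Series dominated by a geometric series *)

Section HalfDominated.
Context {R : realType}.

(** The right-hand side is the sum of 2^-n for N < n <= N + k, in the closed
    form that makes the induction on k immediate. *)
Lemma half_dominated_partial_sum (u : R^nat) N k :
  (forall n, `|u n| <= 2^-1 ^+ n) ->
  `|\sum_(1 <= n < (N + k).+1) u n - \sum_(1 <= n < N.+1) u n|
    <= 2^-1 ^+ N - 2^-1 ^+ (N + k).
Proof.
move=> u_le; elim: k => [|k IH]; first by rewrite addn0 !subrr normr0.
rewrite addnS big_nat_recr//= addrAC.
apply: le_trans (ler_normD _ _) _; apply: le_trans (lerD IH (u_le _)) _.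
by rewrite exprS; lra.
Qed.

Lemma half_dominated_cvg (u : R^nat) : (forall n, `|u n| <= 2^-1 ^+ n) ->
  cvgn (fun N => \sum_(1 <= n < N.+1) u n).
Proof.
move=> u_le.
have -> : (fun N => \sum_(1 <= n < N.+1) u n) = series (fun n => u n.+1).
  by apply/funext => N; rewrite big_add1.
apply: normed_cvg; apply: series_le_cvg (@is_cvg_geometric_series R 1 2^-1 _).
- by move=> n /=.
- by move=> n; apply: geometric_ge0.
- move=> n /=; rewrite mul1r (le_trans (u_le _))// ler_wiXn2l//; lra.
- by rewrite ger0_norm ?invr_ge0 ?ler0n//; lra.
Qed.

Lemma half_dominated_tail (u : R^nat) N : (forall n, `|u n| <= 2^-1 ^+ n) ->
  `|limn (fun N => \sum_(1 <= n < N.+1) u n) - \sum_(1 <= n < N.+1) u n|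
    <= 2^-1 ^+ N.
Proof.
move=> u_le; set S := fun N => _; have cS : cvgn S := half_dominated_cvg u_le.
have : `|S n - S N| @[n --> \oo] --> `|limn S - S N|.
  by apply: cvg_norm; apply: cvgB => //; exact: cvg_cst.
move/cvgr_to_le; apply; near=> n.
have Nn : (N <= n)%N by near: n; exact: nbhs_infty_ge.
have := half_dominated_partial_sum N (n - N) u_le.
rewrite subnKC// => /le_trans; apply.
by rewrite gerBl exprn_ge0// invr_ge0.
Unshelve. all: by end_near. Qed.

(** Weierstrass test along a filter: the tails beyond N cost 2^-N on each
    side, uniformly, and the finite sum up to N converges termwise. *)
Lemma half_dominated_sum_cvg (T : Type) (F : set_system T) (FF : Filter F)
  (u : nat -> T -> R) (l : R^nat) :
  (\forall y \near F, forall n, `|u n y| <= 2^-1 ^+ n) ->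
  (forall n, `|l n| <= 2^-1 ^+ n) ->
  (forall n, u n.+1 @ F --> l n.+1) ->
  limn (fun N => \sum_(1 <= n < N.+1) u n y) @[y --> F]
    --> limn (fun N => \sum_(1 <= n < N.+1) l n).
Proof.
move=> u_le l_le ul; apply/cvgrPdist_le => e e0.
have e3 : 0 < e / 3 by lra.
have [N Ne] : exists N, 2^-1 ^+ N <= e / 3.
  have half1 : `|2^-1 : R| < 1 by rewrite ger0_norm ?invr_ge0 ?ler0n//; lra.
  have := cvgr0_norm_le _ (cvg_expr half1) _ e3; case=> [N _ /(_ N (leqnn N))].
  by rewrite /= ger0_norm ?exprn_ge0 ?invr_ge0//; exists N.
have SN : \sum_(1 <= n < N.+1) u n y @[y --> F] --> \sum_(1 <= n < N.+1) l n.
  rewrite big_add1; under eq_fun do rewrite big_add1.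
  by apply: cvg_big => [|n _]; [exact: add_continuous|exact: ul].
near=> y.
have uy : forall n, `|u n y| <= 2^-1 ^+ n by near: y.
have := half_dominated_tail N uy; have := half_dominated_tail N l_le.
have : `|\sum_(1 <= n < N.+1) l n - \sum_(1 <= n < N.+1) u n y| <= e / 3.
  by near: y; apply: (cvgr_dist_le _ _ SN).
rewrite !ler_norml; lra.
Unshelve. all: by end_near. Qed.

End HalfDominated.

(** * Continuity of the error sum *)

Section ErrorSum.
Context {R : realType}.

Lemma pierce_error_sumE (x : R) : 0 <= x <= 1 ->
  pierce_error_sum x = limn (fun N => \sum_(1 <= n < N.+1) pierce_err n x).
Proof.
move=> x01; congr (limn _); apply/funext => N; apply: eq_bigr => n _.
exact: pierce_errE.
Qed.

(** The index starts at 1 because the term of index 0 is x itself, which does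
    not vanish at the endpoint 1; the error sum starts at 1 as well. *)
Lemma pierce_errS_continuous_on_I (n : nat) (x : R) :
  0 <= x <= 1 -> ~ pierce_E' x ->
  pierce_err n.+1 y @[y --> within `[0, 1] (nbhs x)] --> pierce_err n.+1 x.
Proof.
move=> x01 xE'.
have near01 : \forall y \near within `[0, 1] (nbhs x), 0 <= y <= 1.
  by apply: withinT.
have id_cvg : y @[y --> within `[0, 1] (nbhs x)] --> x.
  by apply: cvg_within_filter; exact: cvg_id.
have [x0|x0] := eqVneq x 0.
  have -> : pierce_err n.+1 x = 0 by rewrite x0 /= pierce_inv_d1_0 mul0r oppr0.
  apply/cvgrPdist_le => e e0; near=> y.
  rewrite sub0r normrN (le_trans (pierce_err_le _ _))//; first by near: y.
  by near: y; apply: (cvgr_le _ id_cvg); rewrite x0.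
have [x1|x1] := eqVneq x 1.
  have near2 : \forall y \near within `[0, 1] (nbhs x), 2^-1 < y.
    by apply: (cvgr_gt _ id_cvg); rewrite x1; lra.
  have -> : pierce_err n.+1 x = 0.
    apply/eqP; rewrite -normr_le0 (le_trans (pierce_errS_le_near1 _ _))//.
      by rewrite x1; lra.
    by rewrite x1 subrr.
  apply/cvgrPdist_le => e e0; near=> y.
  have y2 : 2^-1 < y by near: y.
  have /andP[_ y1] : 0 <= y <= 1 by near: y.
  rewrite sub0r normrN (le_trans (pierce_errS_le_near1 _ _)) ?y2//.
  have : 1 - e <= y by near: y; apply: (cvgr_ge _ id_cvg); rewrite x1; lra.
  lra.
have /andP[xge0 xle1] := x01.
have x0' : 0 < x by rewrite lt_neqAle eq_sym x0.
apply: cvg_within_filter; apply: pierce_err_continuous; first by rewrite x0'.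
move=> xQ; apply: xE'; split => //=.
by rewrite in_itv/= x0' lt_neqAle x1.
Unshelve. all: by end_near. Qed.

Lemma pierce_error_sum_continuous (x : R) : 0 <= x <= 1 -> ~ pierce_E' x ->
  continuous_on_I_at (@pierce_error_sum R) x.
Proof.
move=> x01 xE'; rewrite /continuous_on_I_at (pierce_error_sumE x01).
have near01 : \forall y \near within `[0, 1] (nbhs x), 0 <= y <= 1.
  by apply: withinT.
apply: (@cvg_trans _ (limn (fun N => \sum_(1 <= n < N.+1) pierce_err n y)
    @[y --> within `[0, 1] (nbhs x)])).
  by apply: near_eq_cvg; near=> y; apply/esym/pierce_error_sumE; near: y.
apply: half_dominated_sum_cvg.
- by near=> y => n; apply: pierce_err_bound; near: y.
- by move=> n; exact: pierce_err_bound.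
- by move=> n; exact: pierce_errS_continuous_on_I.
Unshelve. all: by end_near. Qed.

End ErrorSum.

(** * Almost everywhere *)

Lemma rational_negligible (R : realType) :
  (@lebesgue_measure R).-negligible (@rational R).
Proof.
apply/negligibleP; last exact: lebesgue_measure_rat.
apply: countable_measurable; first by move=> t; exact: measurable_set1.
by apply: card_le_trans (card_image_le _ _) _; exact: countableP.
Qed.

Theorem theorem3p16 (R : realType) :
  (forall x : R, (`[0, 1] `\` @pierce_E' R) x ->
     continuous_on_I_at (@pierce_error_sum R) x) /\
  {ae (@lebesgue_measure R), forall x : R, x \in `[0, 1] ->
     continuous_on_I_at (@pierce_error_sum R) x}.
Proof.
split=> [x [/= + xE']|].
  by rewrite in_itv/= => x01; exact: pierce_error_sum_continuous.
apply: negligibleS (@rational_negligible R) => x /= discont.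
apply: contrapT => xirr; apply: discont; rewrite in_itv/= => x01.
by apply: pierce_error_sum_continuous => // -[].
Qed.
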